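(* Suppose that positive integers $m,n$ are coprime. The set of $(m,n)$-Dyck paths is in one-to-one correspondence with the set of $(m,n)$-rank words, via the map $w\mapsto\Pi(w)$ sending an $(m,n)$-rank word $w$ to the path $\Pi(w)$ for which the cells above the path are exactly the cells whose ranks are highlighted in $w$.
   Context: Let $m,n$ be coprime positive integers. Diagram and paths. The $(m,n)$-lattice is the grid of unit squares (cells) filling the rectangle with southwest corner $(0,0)$ and northeast corner $(m,n)$. Cell $(u,v)$, $1\le u\le m$, $1\le v\le n$, is the unit square whose northeast corner is the point $(u,v)$; it lies in column $u$ and row $v$. Its rank is $\gamma(u,v)=mn-un-(n+1-v)m$ (distinct cells have distinct ranks). An $(m,n)$-Dyck path is a lattice path from $(0,0)$ to $(m,n)$ consisting of unit north and east steps and staying weakly above the diagonal $y=\frac{n}{m}x$. It splits the cells into those above the path (on its northwest side) and those below the path (on its southeast side). Rank words. The $(m,n)$-word is the list, in increasing order, of all positive integers of the form $a=mn-km-\ell n$ with integers $k,\ell\ge1$; each such $a$ is written as the letter $a_\ell$, with rank $a$ and color $\ell$. An $(m,n)$-rank word is the $(m,n)$-word with a subset of its letters highlighted, such that if $mn-km-\ell n$ is highlighted then $mn-im-jn$ is highlighted for all $1\le i\le k$, $1\le j\le \ell$. *)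

(* Defs.v *)
From mathcomp Require Import all_boot all_order all_algebra.
From mathcomp Require Import zify.

Set Implicit Arguments.
Unset Strict Implicit.
Unset Printing Implicit Defensive.

Import Order.TTheory GRing.Theory Num.Theory.

Local Open Scope ring_scope.

Variant step := North | East.

Definition is_north (s : step) : bool := if s is North then true else false.
Definition is_east (s : step) : bool := if s is East then true else false.

(* A prefix [p1] of the step sequence ends at the lattice point
   [(count is_east p1, count is_north p1)].  The line [y = (n / m) x] being
   straight, it is enough to compare it with the path at these points. *)
Record dyck_path (m n : nat) := DyckPath {
  steps :> seq step;
  _ : count is_east steps = m;
  _ : count is_north steps = n;
  _ : forall p1 p2, steps = p1 ++ p2 ->
        (n * count is_east p1 <= m * count is_north p1)%N
}.

(* Column [u] is crossed by the single east step from abscissa [u - 1] to [u];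
   cell [(u, v)], whose south side is at height [v - 1], is above the path when
   that step runs at height at most [v - 1]. *)
Definition cell_above (p : seq step) (u v : nat) : Prop :=
  exists p1 p2, [/\ p = p1 ++ East :: p2,
                    (count is_east p1).+1 = u &
                    (count is_north p1 < v)%N].

Definition cell_rank (m n u v : nat) : int :=
  m%:Z * n%:Z - u%:Z * n%:Z - (n%:Z + 1 - v%:Z) * m%:Z.

(* A letter is a pair (rank, color). *)
Definition letter : Type := (int * nat)%type.

Definition letter_rank (m n k l : nat) : int :=
  m%:Z * n%:Z - k%:Z * m%:Z - l%:Z * n%:Z.

(* The bounds [k <= n] and [l <= m] lose nothing (see [mem_mn_word]).  For
   coprime [m] and [n], distinct pairs [(k, l)] give distinct positive ranks. *)
Definition mn_word (m n : nat) : seq letter :=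
  sort (fun x y : letter => x.1 <= y.1)
    [seq x <- [seq (letter_rank m n k l, l) | k <- iota 1 n, l <- iota 1 m]
       | 0 < x.1].

Lemma mem_mn_word (m n : nat) (a : int) (l : nat) :
  (a, l) \in mn_word m n <->
  0 < a /\ (0 < l)%N /\ exists2 k : nat, (0 < k)%N & a = letter_rank m n k l.
Proof.
rewrite mem_sort mem_filter /=; split.
  case/andP=> a0 /allpairsP[[k l'] /= [+ + [aE ->]]].
  by rewrite !mem_iota => /andP[k1 _] /andP[l1 _]; split=> //; split=> //; exists k.
move=> [a0 [l0 [k k0 aE]]]; rewrite a0 /=; apply/allpairsP.
exists (k, l); rewrite /= -aE !mem_iota k0 l0.
by move: a0; rewrite aE /letter_rank; split=> //; nia.
Qed.

(* The boolean attached to a letter tells whether it is highlighted. *)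
Definition highlighted (w : seq (letter * bool)) (a : int) : Prop :=
  exists l : nat, ((a, l), true) \in w.

Record rank_word (m n : nat) := RankWord {
  marked_letters :> seq (letter * bool);
  _ : unzip1 marked_letters = mn_word m n;
  _ : forall k l : nat, (1 <= k)%N -> (1 <= l)%N ->
        highlighted marked_letters (letter_rank m n k l) ->
        forall i j : nat, (1 <= i <= k)%N -> (1 <= j <= l)%N ->
          highlighted marked_letters (letter_rank m n i j)
}.

(* Main.v *)
Require Import Defs.
From mathcomp Require Import all_boot all_order all_algebra.
From mathcomp Require Import zify.
From mathcomp.classical Require Import boolp.

(** Both kinds of objects are encodings of one and the same thing: a set of
    cells closed under moving up and to the left, all of whose cells have
    positive rank.

    A path with [m] east and [n] north steps amounts to the weakly increasing
    sequence of the heights [h_1 <= ... <= h_m] of its east steps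
    ([east_heights_inj], [east_heights_path_of_heights]), and cell [(u, v)] is
    above it exactly when [h_u < v] ([cell_aboveP]).  The path stays weakly
    above the diagonal exactly when it does so after each east step, which says
    [n u <= m h_u].  Since the rank of [(u, v)] is [m (v - 1) - n u], this means
    that all cells above the path have nonnegative rank; and no cell has rank
    zero, because [m] and [n] are coprime ([cell_rank_neq0]).

    On the other side, the letter with coordinates [(k, l)] has the rank of
    the cell in column [l] and in the [k]-th row from the top.  Coprimality
    makes the rank determine the letter ([letter_rank_inj]), so that a rank
    word amounts to the set of its highlighted ranks ([rank_word_inj]), and the
    closure condition on highlighted letters is closure of the set of cells
    under moving up and to the left.

    The two maps are then explicit: [path_of_word] puts the east step of column
    [u] just below the lowest highlighted cell of this column (at height [n] if
    there is none), [word_of_path] highlights the ranks of the cells above the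
    path.  Both preserve the set of cells ([path_of_wordP], [word_of_pathP]),
    and that set determines the path ([dyck_path_inj]) and the word, so they are
    inverse to each other. *)

Set Implicit Arguments.
Unset Strict Implicit.
Unset Printing Implicit Defensive.

Import Order.TTheory GRing.Theory Num.Theory.

(** * Step sequences and the heights of their east steps *)

(** The starting height [b] is a parameter to allow induction on [s]. *)
Fixpoint east_heights (b : nat) (s : seq step) : seq nat :=
  match s with
  | [::] => [::]
  | North :: s' => east_heights b.+1 s'
  | East :: s' => b :: east_heights b s'
  end.

Fixpoint path_of_heights (n b : nat) (hs : seq nat) : seq step :=
  if hs is h :: hs' then nseq (h - b) North ++ East :: path_of_heights n h hs'
  else nseq (n - b) North.

Lemma size_east_heights b s : size (east_heights b s) = count is_east s.
Proof. by elim: s b => [|[] s IHs] b //=; rewrite IHs. Qed.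

Lemma east_heights_cat b s t :
  east_heights b (s ++ t) =
    east_heights b s ++ east_heights (b + count is_north s) t.
Proof.
elim: s b => [|[] s IHs] b /=; rewrite ?addn0 ?IHs //=.
by rewrite addSnnS.
Qed.

Lemma east_heights_le b s :
  all (fun h => h <= b + count is_north s) (east_heights b s).
Proof.
elim: s b => [|[] s IHs] b //=; first by rewrite add1n -addSnnS.
by rewrite leq_addr IHs.
Qed.

Lemma east_heights_sorted b s : path leq b (east_heights b s).
Proof.
elim: s b => [|[] s IHs] b //=; last by rewrite leqnn IHs.
by have := IHs b.+1; case: (east_heights _ _) => //= h hs /andP[/ltnW-> ->].
Qed.

Lemma nth_east_heights_le b s i :
  i < count is_east s -> nth 0 (east_heights b s) i <= b + count is_north s.
Proof. by rewrite -(size_east_heights b) => /(all_nthP 0 (east_heights_le b s)). Qed.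

Lemma nth_east_heights_mono s i j :
  i <= j < count is_east s ->
  nth 0 (east_heights 0 s) i <= nth 0 (east_heights 0 s) j.
Proof.
rewrite -(size_east_heights 0) => /andP[ij js].
apply: (sorted_leq_nth leq_trans leqnn _ (path_sorted (east_heights_sorted 0 s)))
  => //; rewrite inE //.
exact: leq_ltn_trans ij js.
Qed.

(** The heights locate the first east step: a path starting with a north step
    has no east step at its starting height. *)
Lemma east_heights_inj b s t :
  count is_north s = count is_north t ->
  east_heights b s = east_heights b t -> s = t.
Proof.
have noN b' s' hs : east_heights b'.+1 s' <> b' :: hs.
  by move=> E; have := east_heights_sorted b'.+1 s'; rewrite E /= ltnn.
elim: s b t => [|[] s IHs] b [|[] t] //=.
- by move=> [/IHs H] /H ->.
- by move=> _ /noN.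
- by move=> _ /esym /noN.
by move=> /IHs H [/H ->].
Qed.

Lemma east_heights_split b s i : i < count is_east s ->
  exists p1 p2, [/\ s = p1 ++ East :: p2, count is_east p1 = i &
    nth 0 (east_heights b s) i = b + count is_north p1].
Proof.
elim: s b i => [|[] s IHs] b i //=.
  move=> /(IHs b.+1)[p1 [p2 [-> Ei Eh]]].
  by exists (North :: p1), p2; split=> //=; rewrite Eh addSnnS.
case: i => [_|i]; first by exists [::], s; split=> //=; rewrite addn0.
rewrite add1n ltnS => /(IHs b)[p1 [p2 [-> Ei Eh]]].
by exists (East :: p1), p2; split=> //=; rewrite Ei.
Qed.

Lemma cell_aboveP s u v :
  cell_above s u.+1 v <->
  (u < count is_east s) && (nth 0 (east_heights 0 s) u < v).
Proof.
split=> [[p1 [p2 [-> [<-] lt_v]]]|/andP[/(east_heights_split 0)]].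
  rewrite east_heights_cat nth_cat size_east_heights ltnn subnn /= lt_v.
  by rewrite count_cat /= -[X in X < _]addn0 ltn_add2l.
move=> [p1 [p2 [-> <- ->]]] lt_v.
by exists p1, p2.
Qed.

Lemma east_heights_nseq b k s :
  east_heights b (nseq k North ++ s) = east_heights (b + k) s.
Proof. by elim: k b => [|k IHk] b /=; rewrite ?addn0 // IHk addSnnS. Qed.

Lemma east_heights_path_of_heights n b hs :
  path leq b hs -> east_heights b (path_of_heights n b hs) = hs.
Proof.
elim: hs b => [|h hs IHs] b /=.
  by rewrite -[nseq _ _]cats0 east_heights_nseq.
by move=> /andP[bh hsP]; rewrite east_heights_nseq /= subnKC // IHs.
Qed.

Lemma count_north_path_of_heights n b hs :
  path leq b hs -> b <= n -> all (fun h => h <= n) hs ->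
  b + count is_north (path_of_heights n b hs) = n.
Proof.
elim: hs b => [|h hs IHs] b /=.
  by move=> _ bn _; rewrite count_nseq mul1n subnKC.
move=> /andP[bh hsP] bn /andP[hn hsn].
by rewrite count_cat count_nseq mul1n /= add0n addnA subnKC // IHs.
Qed.

(** Between two east steps a path only moves away from the diagonal, so it is
    enough to compare with the diagonal after each east step. *)
Lemma above_diagonal m n s :
  (forall u, u < count is_east s -> n * u.+1 <= m * nth 0 (east_heights 0 s) u) ->
  forall p1 p2, s = p1 ++ p2 -> n * count is_east p1 <= m * count is_north p1.
Proof.
move=> Hs p1 p2 E; case Eu: (count is_east p1) => [|u]; first by rewrite muln0.
have lt_u : u < count is_east p1 by rewrite Eu.
have := Hs u; rewrite E count_cat ltn_addr // => /(_ isT) /leq_trans; apply.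
rewrite leq_mul2l east_heights_cat nth_cat size_east_heights lt_u.
by rewrite nth_east_heights_le ?orbT.
Qed.

(** * Dyck paths are determined by the cells above them *)

Section DyckPaths.
Variables m n : nat.
Implicit Types p q : dyck_path m n.

Lemma dyck_count_east p : count is_east p = m.
Proof. by case: p. Qed.

Lemma dyck_count_north p : count is_north p = n.
Proof. by case: p. Qed.

Lemma dyck_height_ge p u : u < m -> n * u.+1 <= m * nth 0 (east_heights 0 p) u.
Proof.
case: p => s /= sE sN sD lt_u.
have [|p1 [p2 [E Eu ->]]] := @east_heights_split 0 s u; first by rewrite sE.
have /sD : s = rcons p1 East ++ p2 by rewrite cat_rcons.
by rewrite -cats1 !count_cat /= Eu !addn0 addn1.
Qed.

Lemma dyck_height_le p u : u < m -> nth 0 (east_heights 0 p) u <= n.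
Proof.
move=> lt_u; have := @nth_east_heights_le 0 p u.
by rewrite dyck_count_east dyck_count_north; apply.
Qed.

Lemma dyck_cell_aboveP p u v : u < m ->
  cell_above p u.+1 v <-> nth 0 (east_heights 0 p) u < v.
Proof. by move=> lt_u; rewrite cell_aboveP dyck_count_east lt_u. Qed.

Lemma dyck_cell_above_mono p u v u' v' :
  0 < u' <= u -> u <= m -> v <= v' -> cell_above p u v -> cell_above p u' v'.
Proof.
case: u u' => [|u] [|u'] //= le_u le_m le_v.
rewrite !dyck_cell_aboveP ?(leq_ltn_trans _ le_m) // => lt_v.
apply: leq_trans le_v; apply: leq_ltn_trans lt_v.
by apply: nth_east_heights_mono; rewrite dyck_count_east -ltnS le_u.
Qed.

Lemma steps_inj p q : steps p = steps q -> p = q.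
Proof.
case: p q => s a b c [t a' b' c'] /= E; subst t.
by congr DyckPath; apply: Prop_irrelevance.
Qed.

(** The heights are at most [n], so comparing them with [1], ..., [n] is enough
    to tell them apart. *)
Lemma dyck_path_inj p q :
  (forall u v, 1 <= u <= m -> 1 <= v <= n ->
     (cell_above p u v <-> cell_above q u v)) -> p = q.
Proof.
have le_heights p' q' u : u < m ->
    (forall v, 1 <= v <= n -> cell_above q' u.+1 v -> cell_above p' u.+1 v) ->
    nth 0 (east_heights 0 p') u <= nth 0 (east_heights 0 q') u.
  move=> lt_u sub; have := dyck_height_le q' lt_u; rewrite leq_eqVlt.
  case/predU1P=> [->|lt_n]; first exact: dyck_height_le.
  by have := sub _.+1 lt_n; rewrite !dyck_cell_aboveP // ltnS; apply.
move=> Epq; apply: steps_inj; apply: (@east_heights_inj 0).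
  by rewrite !dyck_count_north.
apply: (@eq_from_nth _ 0); first by rewrite !size_east_heights !dyck_count_east.
move=> u; rewrite size_east_heights dyck_count_east => lt_u; apply/eqP.
by rewrite eqn_leq !le_heights // => v vn /Epq; apply.
Qed.

End DyckPaths.

(** * Ranks *)

Section Ranks.
Variables m n : nat.
Hypotheses (hm : 0 < m) (hn : 0 < n) (hmn : coprime m n).

Local Open Scope ring_scope.

Lemma letter_rank_gt0 k l :
  (0 < letter_rank m n k l) = (k * m + l * n < m * n)%N.
Proof. by rewrite /letter_rank; lia. Qed.

Lemma letter_rankE k l : (k <= n)%N ->
  letter_rank m n k l = cell_rank m n l (n.+1 - k)%N.
Proof.
by move=> kn; rewrite /letter_rank /cell_rank -subzn; [nia | exact: leqW].
Qed.

Lemma cell_rankE u v : (v <= n)%N ->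
  cell_rank m n u v = letter_rank m n (n.+1 - v) u.
Proof.
by move=> vn; rewrite /letter_rank /cell_rank -subzn; [nia | exact: leqW].
Qed.

Lemma mem_letter_rank k l : (0 < k)%N -> (0 < l)%N -> 0 < letter_rank m n k l ->
  (letter_rank m n k l, l) \in mn_word m n.
Proof. by move=> k0 l0 a0; apply/mem_mn_word; split=> //; split=> //; exists k. Qed.

Lemma coprime_mul_eq a b a' b' :
  (a <= m)%N -> (0 < a')%N -> (a * n + b' * m = a' * n + b * m)%N -> (a <= a')%N.
Proof.
move=> am a'0 E; rewrite leqNgt; apply/negP=> lt_a.
have dv : (m %| (a - a') * n)%N.
  by apply/dvdnP; exists (b - b')%N; rewrite !mulnBl; lia.
by move: dv; rewrite Gauss_dvdl // => /dvdn_leq; lia.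
Qed.

Lemma letter_rank_inj k l k' l' :
  (0 < l <= m)%N -> (0 < l' <= m)%N ->
  letter_rank m n k l = letter_rank m n k' l' -> k = k' /\ l = l'.
Proof.
move=> /andP[l0 lm] /andP[l'0 l'm]; rewrite /letter_rank => E.
have {}E : (l * n + k * m = l' * n + k' * m)%N by lia.
have le1 := coprime_mul_eq lm l'0 E.
have le2 := coprime_mul_eq l'm l0 (esym E).
have El : l = l' by lia.
subst l'; split=> //; apply/eqP; rewrite -(eqn_pmul2r hm); apply/eqP; lia.
Qed.

Lemma mn_word_letter a l : (a, l) \in mn_word m n ->
  exists k, [/\ (0 < k <= n)%N, (0 < l <= m)%N, a = letter_rank m n k l & 0 < a].
Proof.
move=> /mem_mn_word[a0 [l0 [k k0 Ea]]]; exists k; split=> //;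
  by move: a0; rewrite Ea letter_rank_gt0; nia.
Qed.

Lemma mn_word_color a l l' :
  (a, l) \in mn_word m n -> (a, l') \in mn_word m n -> l = l'.
Proof.
move=> /mn_word_letter[k [_ lm -> _]] /mn_word_letter[k' [_ lm' E _]].
by have [] := letter_rank_inj lm lm' E.
Qed.

Lemma uniq_mn_word : uniq (mn_word m n).
Proof.
rewrite sort_uniq filter_uniq //; apply: allpairs_uniq; rewrite ?iota_uniq //.
move=> [k l] [k' l'] /= _ _ []; rewrite /letter_rank => E El; subst l'.
by congr pair; apply/eqP; rewrite -(eqn_pmul2r hm); apply/eqP; lia.
Qed.

(** Coprimality again: the diagonal meets no lattice point with abscissa
    strictly between [0] and [m], and the southeast corner of a cell is never
    the corner [(m, n)]. *)
Lemma cell_rank_neq0 u v :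
  (1 <= u <= m)%N -> (1 <= v <= n)%N -> cell_rank m n u v != 0.
Proof.
move=> /andP[u1 um] /andP[v1 vn]; apply/eqP; rewrite /cell_rank => E.
have {}E : (u * n = v.-1 * m)%N by nia.
have : (n %| v.-1 * m)%N by rewrite -E dvdn_mull.
rewrite Gauss_dvdl 1?coprime_sym // => /dvdn_leq; nia.
Qed.

Lemma cell_above_rank_gt0 (p : dyck_path m n) u v :
  (1 <= u <= m)%N -> (1 <= v <= n)%N -> cell_above p u v ->
  0 < cell_rank m n u v.
Proof.
move=> um vn; rewrite lt_neqAle eq_sym cell_rank_neq0 //=.
case: u um => // u um; rewrite dyck_cell_aboveP // => lt_v.
have := dyck_height_ge p um; rewrite /cell_rank; nia.
Qed.

(** * Rank words are determined by their highlighted cells *)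

Lemma uniq_map_inj (T1 T2 : eqType) (f : T1 -> T2) (s : seq T1) :
  uniq [seq f x | x <- s] -> {in s &, injective f}.
Proof.
elim: s => [|z s IHs] //= /andP[fz us] x y; rewrite !inE.
case/predU1P=> [->|xs] /predU1P[->|ys] // E; last exact: IHs.
- by rewrite E map_f in fz.
- by rewrite -E map_f in fz.
Qed.

Definition is_highlighted (w : seq (letter * bool)) (a : int) : bool :=
  has (fun x => x.2 && (x.1.1 == a)) w.

Lemma highlightedP (w : seq (letter * bool)) a :
  reflect (highlighted w a) (is_highlighted w a).
Proof.
apply: (iffP hasP) => [[[[a' l] b] /= wx /andP[b1 /eqP <-]]|[l wx]].
  by exists l; rewrite b1 in wx.
by exists (a, l, true) => //=; rewrite eqxx.
Qed.

Implicit Type w : rank_word m n.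

Lemma rank_word_letters w : unzip1 w = mn_word m n.
Proof. by case: w. Qed.

Lemma highlighted_letter w a : highlighted w a ->
  exists k l, [/\ (0 < k <= n)%N, (0 < l <= m)%N, a = letter_rank m n k l & 0 < a].
Proof.
move=> [l wx]; have /mn_word_letter[k H] : (a, l) \in mn_word m n.
  by rewrite -(rank_word_letters w); apply/mapP; exists (a, l, true).
by exists k, l.
Qed.

Lemma highlighted_cell_mono w u v u' v' :
  (1 <= u' <= u)%N -> (1 <= v <= v')%N -> (v' <= n)%N ->
  highlighted w (cell_rank m n u v) -> highlighted w (cell_rank m n u' v').
Proof.
case: w => s sL sC /= um vn v'n; rewrite !cell_rankE //; last by lia.
by move/sC; apply; lia.
Qed.

(** A highlighted rank could in principle come with several colors; by
    coprimality it comes with one, so the ranks alone give back all the marks. *)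
Lemma rank_wordE w :
  w = [seq (x, is_highlighted w x.1) | x <- mn_word m n] :> seq _.
Proof.
rewrite -[in RHS](rank_word_letters w) -map_comp -[LHS]map_id.
apply/eq_in_map => -[[a l] b] wx /=; congr pair; apply/idP/idP => [b1|].
  by apply/highlightedP; exists l; rewrite b1 in wx.
move=> /highlightedP[l' wx'].
have letter_mem y : y \in marked_letters w -> y.1 \in mn_word m n.
  by rewrite -(rank_word_letters w) => wy; apply: map_f.
have El := mn_word_color (letter_mem _ wx) (letter_mem _ wx'); subst l'.
(* No letter occurs twice in [w], so it cannot carry two different marks. *)
have uw : uniq (unzip1 w) by rewrite rank_word_letters uniq_mn_word.
have inj_w : {in marked_letters w &, injective fst}.
  exact: uniq_map_inj.
by have [] := inj_w _ _ wx wx' erefl.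
Qed.

Lemma marked_letters_inj w w' : marked_letters w = marked_letters w' -> w = w'.
Proof.
case: w w' => s a b [t a' b'] /= E; subst t.
by congr RankWord; apply: Prop_irrelevance.
Qed.

Lemma rank_word_inj w w' :
  (forall u v, (1 <= u <= m)%N -> (1 <= v <= n)%N ->
     (highlighted w (cell_rank m n u v) <-> highlighted w' (cell_rank m n u v))) ->
  w = w'.
Proof.
move=> E; apply: marked_letters_inj; rewrite (rank_wordE w) (rank_wordE w').
apply/eq_in_map => -[a l] /mn_word_letter[k [kn lm -> _]] /=; congr pair.
rewrite letter_rankE; last by lia.
have {}E : highlighted w (cell_rank m n l (n.+1 - k)) <->
           highlighted w' (cell_rank m n l (n.+1 - k)) by apply: E; lia.
by apply/highlightedP/highlightedP => /E.
Qed.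

(** * From rank words to paths *)

Definition word_height w (u : nat) : nat :=
  find (fun v => is_highlighted w (cell_rank m n u v)) (iota 1 n).

Definition word_heights w : seq nat := [seq word_height w u | u <- iota 1 m].

Lemma word_height_le w u : (word_height w u <= n)%N.
Proof. by rewrite -[leqRHS](size_iota 1 n) find_size. Qed.

(** By closure, the highlighted cells of a column are all those from the lowest
    one upward. *)
Lemma word_height_ltP w u v : (1 <= u)%N -> (1 <= v <= n)%N ->
  (word_height w u < v)%N <-> highlighted w (cell_rank m n u v).
Proof.
move=> u1 /andP[v1 vn]; split=> [lt_v | hv].
  have lt_n := leq_trans lt_v vn.
  have : has (fun v => is_highlighted w (cell_rank m n u v)) (iota 1 n).
    by rewrite has_find size_iota.
  move=> /(nth_find 0%N); rewrite nth_iota // add1n => /highlightedP.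
  by apply: highlighted_cell_mono; rewrite ?u1 ?leqnn.
rewrite ltnNge; apply/negP=> le_v.
have lt_v : (v.-1 < word_height w u)%N by rewrite prednK.
move/highlightedP: hv; have := before_find 0%N lt_v.
rewrite nth_iota; last by rewrite prednK.
by rewrite add1n prednK // => ->.
Qed.

Lemma word_height_mono w u u' :
  (1 <= u' <= u)%N -> (word_height w u' <= word_height w u)%N.
Proof.
move=> uu'; have := word_height_le w u; rewrite leq_eqVlt.
case/predU1P=> [->|lt_n]; first exact: word_height_le.
rewrite -ltnS; apply/word_height_ltP => //; first by case/andP: uu'.
apply: (@highlighted_cell_mono w u (word_height w u).+1); rewrite ?leqnn //.
by apply/word_height_ltP; lia.
Qed.

Lemma word_height_ge w u : (1 <= u <= m)%N -> (n * u <= m * word_height w u)%N.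
Proof.
move=> /andP[u1 um]; have := word_height_le w u; rewrite leq_eqVlt.
case/predU1P=> [->|lt_n]; first by rewrite mulnC leq_mul2r um orbT.
(* The lowest highlighted cell of the column has positive rank. *)
have : highlighted w (cell_rank m n u (word_height w u).+1).
  by apply/word_height_ltP.
by move=> /highlighted_letter[k [l [_ _ _]]]; rewrite /cell_rank; nia.
Qed.

Lemma sorted_word_heights w : path leq 0 (word_heights w).
Proof.
rewrite path_sortedE; last exact: leq_trans.
apply/andP; split; first by apply/allP.
rewrite sorted_map; apply: (@sub_in_sorted _ (fun u => 0 < u)%N ltn).
- move=> u' u; rewrite unfold_in => u'0 _ lt_u.
  by apply: word_height_mono; rewrite u'0 ltnW.
- by apply/allP=> u; rewrite mem_iota => /andP[].
exact: iota_ltn_sorted.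
Qed.

Definition word_steps w : seq step := path_of_heights n 0 (word_heights w).

Lemma east_heights_word_steps w : east_heights 0 (word_steps w) = word_heights w.
Proof. exact/east_heights_path_of_heights/sorted_word_heights. Qed.

Lemma count_east_word_steps w : count is_east (word_steps w) = m.
Proof.
by rewrite -(size_east_heights 0) east_heights_word_steps size_map size_iota.
Qed.

Lemma count_north_word_steps w : count is_north (word_steps w) = n.
Proof.
rewrite -[LHS]add0n; apply: count_north_path_of_heights => //.
  exact: sorted_word_heights.
by apply/allP => _ /mapP[u _ ->]; apply: word_height_le.
Qed.

Lemma nth_word_heights w u :
  (u < m)%N -> nth 0%N (word_heights w) u = word_height w u.+1.
Proof. by move=> lt_u; rewrite (nth_map 0%N) ?size_iota // nth_iota. Qed.

Lemma word_steps_above_diagonal w p1 p2 : word_steps w = p1 ++ p2 ->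
  (n * count is_east p1 <= m * count is_north p1)%N.
Proof.
apply: above_diagonal => u.
rewrite count_east_word_steps east_heights_word_steps => lt_u.
by rewrite nth_word_heights // word_height_ge.
Qed.

Definition path_of_word w : dyck_path m n :=
  DyckPath (count_east_word_steps w) (count_north_word_steps w)
           (@word_steps_above_diagonal w).

Lemma path_of_wordP w u v : (1 <= u <= m)%N -> (1 <= v <= n)%N ->
  (cell_above (path_of_word w) u v <-> highlighted w (cell_rank m n u v)).
Proof.
case: u => // u um vn; rewrite dyck_cell_aboveP //= east_heights_word_steps.
by rewrite nth_word_heights // word_height_ltP.
Qed.

(** * From paths to rank words *)

Implicit Type p : dyck_path m n.

(** The row of the cell carrying the letter [x] is recovered by searching for
    the row that gives the right rank; its column is the color [x.2]. *)
Definition letter_above p (x : letter) : bool :=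
  has (fun v => (cell_rank m n x.2 v == x.1) &&
                (nth 0%N (east_heights 0 p) x.2.-1 < v)%N) (iota 1 n).

Definition path_letters p : seq (letter * bool) :=
  [seq (x, letter_above p x) | x <- mn_word m n].

Lemma highlighted_path_letters p u v : (1 <= u <= m)%N -> (1 <= v <= n)%N ->
  (cell_above p u v <-> highlighted (path_letters p) (cell_rank m n u v)).
Proof.
move=> um vn; split=> [above|].
  have rank_gt0 := cell_above_rank_gt0 um vn above.
  exists u; apply/mapP; exists (cell_rank m n u v, u).
    by move: rank_gt0; rewrite cell_rankE; [apply: mem_letter_rank|]; lia.
  congr pair; apply/esym/hasP; exists v; first by rewrite mem_iota; lia.
  rewrite eqxx /=; case: u um above {rank_gt0} => // u um.
  by rewrite dyck_cell_aboveP.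
move=> [l /mapP[[a l'] al [Ea El] /esym /hasP[v' v'n /= /andP[/eqP E lt_v]]]].
rewrite -{}Ea -{}El {a l'} in al E lt_v.
have {}v'n : (1 <= v' <= n)%N by move: v'n; rewrite mem_iota; lia.
have [_ [_ lm _ _]] := mn_word_letter al.
have [Ev El] : (n.+1 - v' = n.+1 - v)%N /\ l = u.
  apply: letter_rank_inj => //; rewrite -!cell_rankE //; lia.
have {}Ev : v' = v by lia.
subst l v'; case: u um lt_v {E al lm} => // u um.
by rewrite dyck_cell_aboveP.
Qed.

Lemma unzip1_path_letters p : unzip1 (path_letters p) = mn_word m n.
Proof. by rewrite /unzip1 -map_comp map_id. Qed.

Lemma path_letters_closed p k l : (1 <= k)%N -> (1 <= l)%N ->
  highlighted (path_letters p) (letter_rank m n k l) ->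
  forall i j, (1 <= i <= k)%N -> (1 <= j <= l)%N ->
    highlighted (path_letters p) (letter_rank m n i j).
Proof.
move=> k1 l1 hkl i j ik jl.
have [kn lm] : (k <= n)%N /\ (l <= m)%N.
  have [l' /(map_f fst)] := hkl.
  rewrite -/(unzip1 _) unzip1_path_letters => /mn_word_letter[_ [_ _ _]] /=.
  by rewrite letter_rank_gt0; nia.
rewrite letter_rankE; last by lia.
apply/highlighted_path_letters; [lia|lia|].
apply: (@dyck_cell_above_mono _ _ p l (n.+1 - k)) => //; first by lia.
by apply/highlighted_path_letters; rewrite -?letter_rankE //; lia.
Qed.

Definition word_of_path p : rank_word m n :=
  RankWord (unzip1_path_letters p) (@path_letters_closed p).

Lemma word_of_pathP p u v : (1 <= u <= m)%N -> (1 <= v <= n)%N ->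
  (cell_above p u v <-> highlighted (word_of_path p) (cell_rank m n u v)).
Proof. exact: highlighted_path_letters. Qed.

End Ranks.

(** * The correspondence *)

Theorem theorem15 (m n : nat) (hm : (0 < m)%N) (hn : (0 < n)%N)
    (hmn : coprime m n) :
  exists Pi : rank_word m n -> dyck_path m n,
    (forall (w : rank_word m n) (p : dyck_path m n),
       p = Pi w <->
       (forall u v : nat, (1 <= u <= m)%N -> (1 <= v <= n)%N ->
          (cell_above p u v <-> highlighted w (cell_rank m n u v)))) /\
    bijective Pi.
Proof.
exists (path_of_word hm hn hmn); split=> [w p|].
  split=> [-> u v um vn | Hp]; first exact: path_of_wordP.
  by apply: dyck_path_inj => u v um vn; rewrite path_of_wordP ?Hp.
exists (word_of_path hm hn hmn) => [w|p].
  apply: (rank_word_inj hm hn hmn) => u v um vn.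
  by rewrite -word_of_pathP // path_of_wordP.
by apply: dyck_path_inj => u v um vn; rewrite path_of_wordP // -word_of_pathP.
Qed.
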